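(* Let $w\in\Sigma_n$ and let $\gamma$ be an increasing chain in the labeled Bruhat order from $w$ to $w_0$. Then: (1) if $u\xrightarrow{(k,b)}v$ is a labeled cover in $\gamma$, then $u^{-1}v=(k,l)$ for some $l>k$; (2) the set of pairs $(k,b)$ with $k,b$ positive integers, $k+b\le n$, and $(k,b)$ not the label of a cover in $\gamma$, is an rc-graph.
   Context: $\Sigma_n$ is the symmetric group on $\{1,\dots,n\}$, $\ell(w)$ the number of inversions, $w_0=n\cdots21$, $s_a=(a,a{+}1)$. Bruhat covers: $u\lessdot v$ iff $v=u\cdot(k,l)$ (swapping positions $k<l$) with $u(k)<u(l)$ and no $k<i<l$ has $u(k)<u(i)<u(l)$. The labeled Bruhat order has an edge $u\xrightarrow{(k,b)}v$ whenever $u\lessdot v$, $u^{-1}v=(i,j)$ with $i\le k<j$ and $b=u(i)=v(j)$. A chain $u_0\xrightarrow{(k_1,b_1)}u_1\to\cdots\xrightarrow{(k_m,b_m)}u_m$ is increasing if its labels strictly increase in lexicographic order ($(k,b)<(j,a)$ iff $k<j$, or $k=j$ and $b<a$). Let $P_n=\{(k,b)\in\mathbb{Z}_{>0}^2:k+b\le n\}$. For $R\subseteq P_n$ order its elements by $(k,b)\le(j,a)$ iff $k<j$, or $k=j$ and $b\ge a$; listing them in this order as $(k_1,b_1),\dots,(k_m,b_m)$, set $d(R)=(k_1+b_1-1,\dots,k_m+b_m-1)$. $R$ is an rc-graph (associated to $w$) if $d(R)$ is a reduced decomposition, i.e. $w=s_{k_1+b_1-1}\cdots s_{k_m+b_m-1}$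 with $m=\ell(w)$ for some (hence the) permutation $w$. *)

(* Defs.v *)
From mathcomp Require Import all_boot all_fingroup.
From mathcomp Require Import finmap.

Set Implicit Arguments.
Unset Strict Implicit.
Unset Printing Implicit Defensive.

(* The symmetric group on {1, ..., n} is 'S_n, the permutations of
   'I_n = {0, ..., n-1}: the ordinal i stands for the integer i.+1.
   Labels, letters of words and elements of P_n are plain naturals and keep
   their 1-based values. *)

(* Product of permutations as composition of functions, (u v)(x) = u (v x);
   MathComp's own product on 'S_n is the opposite one. *)
Definition pmul (n : nat) (u v : 'S_n) : 'S_n := (v * u)%g.

Definition perm_length (n : nat) (w : 'S_n) : nat :=
  #|[set p : 'I_n * 'I_n | (p.1 < p.2) && (w p.2 < w p.1)]|.

Definition longest (n : nat) : 'S_n := perm (@rev_ord_inj n).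

(* s_a = (a, a+1) for 1 <= a < n, that is the ordinals a.-1 and a; the value
   is the junk value 1 for other a. *)
Definition simple_transp (n a : nat) : 'S_n :=
  if (insub a.-1, insub a) is (Some i, Some j) then tperm i j else 1%g.

Definition bruhat_cover (n : nat) (u v : 'S_n) : bool :=
  [exists k : 'I_n, exists l : 'I_n,
    [&& k < l, v == pmul u (tperm k l), u k < u l
      & [forall i : 'I_n, (k < i < l) ==> ~~ (u k < u i < u l)]]].

Definition label : Type := (nat * nat)%type.

Definition labeled_cover (n : nat) (u : 'S_n) (kb : label) (v : 'S_n) : bool :=
  bruhat_cover u v &&
  [exists i : 'I_n, exists j : 'I_n,
    [&& pmul u^-1%g v == tperm i j, i.+1 <= kb.1 < j.+1,
        kb.2 == (u i).+1 & kb.2 == (v j).+1]].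

(* A candidate edge u --kb--> v is the triple (u, kb, v); a chain is the
   sequence of its edges. *)
Definition edge (n : nat) : Type := ('S_n * label * 'S_n)%type.

Fixpoint is_chain (n : nat) (x : 'S_n) (g : seq (edge n)) (y : 'S_n) : bool :=
  match g with
  | [::] => x == y
  | (u, kb, v) :: g' => [&& u == x, labeled_cover u kb v & is_chain v g' y]
  end.

Definition chain_labels (n : nat) (g : seq (edge n)) : seq label :=
  [seq e.1.2 | e <- g].

Definition label_lt (x y : label) : bool :=
  (x.1 < y.1) || ((x.1 == y.1) && (x.2 < y.2)).

Definition increasing_chain (n : nat) (x : 'S_n) (g : seq (edge n))
    (y : 'S_n) : bool :=
  is_chain x g y && sorted label_lt (chain_labels g).

Definition P (n : nat) : {fset nat * nat} :=
  [fset kb in [seq (k, b) | k <- iota 1 n, b <- iota 1 n]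
     | kb.1 + kb.2 <= n]%fset.

(* Unlike in [label_lt], second components decrease when the first agree. *)
Definition rc_le (x y : nat * nat) : bool :=
  (x.1 < y.1) || ((x.1 == y.1) && (y.2 <= x.2)).

Definition rc_word (R : {fset nat * nat}) : seq nat :=
  [seq kb.1 + kb.2 - 1 | kb <- sort rc_le (enum_fset R)].

Definition word_prod (n : nat) (d : seq nat) : 'S_n :=
  foldr (fun a w => pmul (simple_transp n a) w) 1%g d.

Definition reduced_decomposition (n : nat) (w : 'S_n) (d : seq nat) : bool :=
  (w == word_prod n d) && (size d == perm_length w).

Definition rc_graph_of (n : nat) (R : {fset nat * nat}) (w : 'S_n) : Prop :=
  (R `<=` P n)%fset /\ reduced_decomposition w (rc_word R).

Definition rc_graph (n : nat) (R : {fset nat * nat}) : Prop :=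
  exists w : 'S_n, rc_graph_of R w.

(* Main.v *)
(** Reading the chain backward from [w_0], every edge labelled [(k,b)] starts at a
    permutation that agrees with [w_0] left of position [k], so the edge
    exchanges position [k] with some [l > k], and [(k,b)] lies in [P n]. The full
    set [P n] gives a reduced word of [w_0]. Going backward along the chain,
    each edge removes its label from the set, that is one letter from the word;
    by the increasing condition the word around this letter is explicit enough
    to see that the product is multiplied by the transposition [(k,l)]. Since a
    cover changes the length by one, the word stays reduced. *)

Require Import Defs.
From mathcomp Require Import all_boot all_fingroup.
From mathcomp Require Import finmap.
From mathcomp Require Import zify.

Set Implicit Arguments.
Unset Strict Implicit.
Unset Printing Implicit Defensive.

(** * Labeled covers and length *)

Lemma tperm_eq_lt (n : nat) (i j k l : 'I_n) :
  i < j -> k < l -> tperm i j = tperm k l -> i = k /\ j = l.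
Proof.
move=> ij kl eqt; have := congr1 (fun s : 'S_n => s k) eqt.
rewrite /= tpermL; case: tpermP => [-> ->|kj li|_ _ kE] //; last by rewrite kE ltnn in kl.
by rewrite -li kj ltnNge ltnW in kl.
Qed.

(** The cover and its label each provide a pair of positions; the transposition [u^-1 v] determines
    its ordered pair, so the two coincide. *)
Lemma labeled_coverP (n : nat) (u v : 'S_n) (k b : nat) :
  labeled_cover u (k, b) v ->
  exists i l : 'I_n, [/\ i < k <= l, v = pmul u (tperm i l), b = (u i).+1,
    u i < u l & forall m : 'I_n, i < m < l -> ~~ (u i < u m < u l)].
Proof.
case/andP=> /existsP[i /existsP[l /and4P[il /eqP vE uil /forallP between]]].
case/existsP=> i' /existsP[l' /and4P[/eqP uvE ikl /eqP bE _]].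
have [iE lE] : i' = i /\ l' = l.
  apply: tperm_eq_lt => //; last by rewrite -uvE vE /pmul mulgK.
  by case/andP: ikl => /leq_trans h /h.
subst i' l'; exists i, l; split=> // m; exact/implyP/between.
Qed.

(* Conjugating pairs of positions by the transposition matches the inversions
   of [u] and [v], except for pairs whose order it reverses; there the cover
   condition makes the pair an inversion of both or of neither. *)
Lemma perm_length_cover (n : nat) (u : 'S_n) (k l : 'I_n) :
    k < l -> u k < u l ->
    (forall m : 'I_n, k < m < l -> ~~ (u k < u m < u l)) ->
  perm_length (pmul u (tperm k l)) = (perm_length u).+1.
Proof.
move=> kl ukl between; rewrite /perm_length; pose t := tperm k l.
pose f (p : 'I_n * 'I_n) :=
  if (p.1 < p.2) == (t p.1 < t p.2) then (t p.1, t p.2) else p.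
have fK : involutive f.
  move=> p; rewrite /f; case h: (_ == (t p.1 < _)) => /=; last by rewrite h.
  by rewrite /t !tpermK -(eqP h) eqxx -surjective_pairing.
have inj_u (p q : 'I_n) : p <> q -> u p <> u q :> nat.
  by move=> npq /val_inj /perm_inj.
(* The extra inversion of the product is [(k, l)]; [f] matches the others. *)
rewrite (cardsD1 (k, l)) inE /pmul !permM tpermL tpermR /= kl ukl add1n.
congr _.+1; rewrite -(card_imset _ (inv_inj fK)) (can_imset_pre _ fK).
apply: eq_card => -[p q]; rewrite !inE /f /= !permM.
have npq (x y : 'I_n) : x <> y -> x <> y :> nat by move=> nxy /val_inj.
rewrite /t.
have := between p; have := between q.
case: (tpermP k l p) => [->|->|/[dup]/inj_u ? /npq ? /[dup]/inj_u ? /npq ?];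
  case: (tpermP k l q) => [->|->|/[dup]/inj_u ? /npq ? /[dup]/inj_u ? /npq ?];
  case: ifP; rewrite xpair_eqE -!val_eqE /= ?tpermL ?tpermR ?tpermD;
  rewrite -?val_eqE /=; lia.
Qed.

(** * Edges of an increasing chain to [w_0] *)

(** The values from [n - i] on are already taken at the positions left of [i]. *)
Lemma top_fixed_bound (n : nat) (x : 'S_n) (i p : 'I_n) :
  (forall m : 'I_n, m < i -> x m = rev_ord m) -> i <= p -> x p + i < n.
Proof.
move=> top ip; rewrite ltnNge; apply/negP => xp.
have lt_i : rev_ord (x p) < i by move: (ltn_ord (x p)) => /=; lia.
have := top _ lt_i; rewrite rev_ordK => /perm_inj /(congr1 val) /= pE; lia.
Qed.

(** The label begins with the exchanged position itself, as in (1); the last condition serves to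
    place the label in [P n]. *)
Definition staircase_edge (n : nat) (e : edge n) : Prop :=
  exists i l : 'I_n,
    [/\ e = (e.1.1, (i.+1, (e.1.1 i).+1), pmul e.1.1 (tperm i l)),
        i < l, e.1.1 i < e.1.1 l,
        forall m : 'I_n, i < m < l -> ~~ (e.1.1 i < e.1.1 m < e.1.1 l)
      & forall m : 'I_n, m < i -> e.1.1 m = rev_ord m].

(* A cover exchanging a position left of [k] would have position [k] strictly
   in between. *)
Lemma labeled_cover_staircase (n : nat) (u v : 'S_n) (k b : nat) :
    labeled_cover u (k, b) v ->
    (forall m : 'I_n, m.+1 < k -> v m = rev_ord m) ->
    (forall m : 'I_n, m.+1 = k -> b <= v m) ->
  staircase_edge (u, (k, b), v).
Proof.
move=> /labeled_coverP[i [l [/andP[ik kl] -> bE uil between]]] v_top v_k.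
rewrite /staircase_edge.
have lt_k1 : k.-1 < n by move: (ltn_ord l); lia.
pose k1 := Ordinal lt_k1; have k1E : k1.+1 = k by apply: prednK; lia.
have {}v_top (m : 'I_n) : m < k1 -> (pmul u (tperm i l)) m = rev_ord m.
  by rewrite -ltnS k1E; apply: v_top.
have ik1E : i = k1.
  apply/val_inj/eqP; rewrite eqn_leq -ltnS k1E ik leqNgt /=; apply/negP => ik1.
  (* Here [u l = v i = n-1-i], while [u i < u k1] by [v_k] and [u k1 <= n-1-k1] by the bound, so
     [k1] violates [between]. *)
  have := v_top _ ik1; have := between k1; have := v_k _ k1E.
  have := top_fixed_bound v_top (leqnn _).
  rewrite !permM tpermL tpermD -?val_eqE /=; try lia.
  move=> h1 h2 h3 /(congr1 val) /=; lia.
rewrite -ik1E in k1E v_top.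
exists i, l; rewrite k1E bE /=; split=> // [|m mi]; first by rewrite -k1E.
rewrite -v_top // permM tpermD // -val_eqE /=; lia.
Qed.

(* Backward induction: the positions left of [k] already carry their values in
   [w_0], and position [k] carries a value larger than [b]; with 0-based values
   this last condition is [b <= v m] in [labeled_cover_staircase]. *)
Lemma increasing_chain_head (n : nat) (x : 'S_n) (e : edge n)
    (g : seq (edge n)) :
  increasing_chain x (e :: g) (longest n) -> staircase_edge e.
Proof.
elim: g x e => [|e' g IHg] x [[u [k b]] v] /andP[/= /and3P[_ cov chain]].
  move=> _; have vrev m : v m = rev_ord m by rewrite (eqP chain) permE.
  apply: labeled_cover_staircase (cov) _ _ => // m mk.
  have [i [l [/andP[ik kl] vE bE uil _]]] := labeled_coverP cov.
  have /(congr1 val) : v l = u i by rewrite vE permM tpermR.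
  rewrite bE !vrev /=; move: (ltn_ord l); lia.
case/andP=> lt_e sorted_g.
have [//|i' [l' [e'E il' uil' _ v_top]]] := IHg v e' _.
  by apply/andP; split.
case: e' e'E chain lt_e {IHg sorted_g} il' uil' v_top => [[v' kb'] y] /= [-> _].
case/and3P=> /eqP v'E _ _; subst v' => lt_e il' uil' v_top.
rewrite /label_lt /= in lt_e.
apply: (labeled_cover_staircase (cov)) => m mk; first by apply: v_top; lia.
have [i [l [/andP[ik kl] vE bE uil _]]] := labeled_coverP cov.
(* If the next label also begins with [k], its larger second component gives the claim; otherwise
   position [k] already agrees with [w_0], and the bound at [l] applies. *)
have [ki'|i'k] := ltnP k i'.+1; last first.
  have -> : m = i' by apply: val_inj => /=; lia.
  lia.
have lt_k : k < n by move: (ltn_ord i'); lia.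
have top_k (p : 'I_n) : p < Ordinal lt_k -> v p = rev_ord p.
  by move=> pk; apply: v_top; apply: leq_trans pk ki'.
have := top_fixed_bound top_k kl.
have lt_m : m < Ordinal lt_k by rewrite /= -mk.
rewrite (top_k m lt_m) vE permM tpermR /=; lia.
Qed.

Lemma increasing_chain_edges (n : nat) (x : 'S_n) (g : seq (edge n)) :
  increasing_chain x g (longest n) -> forall e, e \in g -> staircase_edge e.
Proof.
elim: g x => [//|e g IHg] x inc e'; rewrite inE => /predU1P[->|].
  exact: increasing_chain_head inc.
case: e inc => [[u kb] v] /andP[/= /and3P[_ _ chain] /path_sorted sorted_g].
by apply: (IHg v); apply/andP.
Qed.

(** * Words acting on the naturals *)

(** The simple transposition on 1-based naturals: words act without bounds on their letters. *)
Definition swap_succ (a x : nat) : nat :=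
  if x == a then a.+1 else if x == a.+1 then a else x.

Definition word_act (d : seq nat) (x : nat) : nat := foldr swap_succ x d.

Lemma swap_succK (a : nat) : involutive (swap_succ a).
Proof. move=> x; rewrite /swap_succ; do 4?case: ifP; lia. Qed.

Lemma word_act_cat (d e : seq nat) (x : nat) :
  word_act (d ++ e) x = word_act d (word_act e x).
Proof. exact: foldr_cat. Qed.

Lemma word_act_inj (d : seq nat) : injective (word_act d).
Proof. by elim: d => [|a d IHd] x y //= /(inv_inj (swap_succK a)) /IHd. Qed.

Lemma word_act_fix (d : seq nat) (x : nat) :
  all (fun a => (x != a) && (x != a.+1)) d -> word_act d x = x.
Proof.
elim: d => [|a d IHd] //= /andP[/andP[xa xSa] /IHd ->].
by rewrite /swap_succ (negPf xa) (negPf xSa).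
Qed.

Lemma simple_transpE (n a : nat) (i : 'I_n) :
  0 < a < n -> (simple_transp n a i).+1 = swap_succ a i.+1.
Proof.
case: a => // a /= an; rewrite /simple_transp /= (insubT (fun j => j < n) (ltnW an)).
rewrite (insubT (fun j => j < n) an) /swap_succ /= eqSS.
case: tpermP => [->|->|/eqP + /eqP] /=; rewrite ?eqxx -?val_eqE /=.
- by [].
- by rewrite gtn_eqF.
- by move=> /negPf -> /negPf; rewrite eqSS => ->.
Qed.

Lemma word_prodE (n : nat) (d : seq nat) (i : 'I_n) :
  all (fun a => 0 < a < n) d -> (word_prod n d i).+1 = word_act d i.+1.
Proof.
elim: d => [|a d IHd] /=; first by rewrite perm1.
by case/andP=> an /IHd <-; rewrite permM simple_transpE.
Qed.

Lemma iota_rcons (m c : nat) : iota m c.+1 = rcons (iota m c) (m + c).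
Proof. by rewrite -[c.+1]addn1 iotaD cats1. Qed.

(* Rightmost letters act first, so a decreasing word carries its last letter
   all the way up. *)
Lemma word_act_rev_iota (m c : nat) : word_act (rev (iota m c)) m = m + c.
Proof.
elim: c => [|c IHc]; first by rewrite addn0.
by rewrite iota_rcons rev_rcons /= IHc /swap_succ eqxx addnS.
Qed.

Lemma word_act_rev_iota_down (m c x : nat) :
  m < x <= m + c -> word_act (rev (iota m c)) x = x.-1.
Proof.
elim: c => [|c IHc]; first by lia.
rewrite iota_rcons rev_rcons /= => /andP[mx xc].
have [xle|xgt] := leqP x (m + c).
  by rewrite IHc ?mx // /swap_succ; do 2?case: ifP; lia.
rewrite word_act_fix ?all_rev; first by rewrite /swap_succ; do 2?case: ifP; lia.
by apply/allP => a; rewrite mem_iota; lia.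
Qed.

(** * The elements of [P n] in reading order *)

Definition stair_row (k : nat) (s : seq nat) : seq (nat * nat) :=
  [seq (k, b) | b <- rev s].

Definition stair_rows (n : nat) (s : seq nat) : seq (nat * nat) :=
  flatten [seq stair_row k (iota 1 (n - k)) | k <- s].

(** Rows come by increasing [k], each with [b] decreasing, as [rc_le] requires. *)
Definition staircase (n : nat) : seq (nat * nat) := stair_rows n (iota 1 n).

Definition diagonals (s : seq (nat * nat)) : seq nat :=
  [seq kb.1 + kb.2 - 1 | kb <- s].

Lemma diagonals_cat (s t : seq (nat * nat)) :
  diagonals (s ++ t) = diagonals s ++ diagonals t.
Proof. exact: map_cat. Qed.

Lemma diagonals_row (k b c : nat) :
  diagonals (stair_row k.+1 (iota b.+1 c)) = rev (iota (k + b).+1 c).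
Proof.
rewrite /diagonals /stair_row -map_comp map_rev; congr rev.
rewrite -addnS iotaDl.
by apply: eq_map => i /=; lia.
Qed.

Lemma mem_stair_row (k : nat) (s : seq nat) (p : nat * nat) :
  (p \in stair_row k s) = (p.1 == k) && (p.2 \in s).
Proof.
apply/mapP/andP => [[b + ->]|[/eqP <- ps]]; first by rewrite mem_rev.
by exists p.2; rewrite ?mem_rev //; case: p {ps}.
Qed.

Lemma mem_stair_rows (n : nat) (s : seq nat) (p : nat * nat) :
  (p \in stair_rows n s) = [&& p.1 \in s, 0 < p.2 & p.1 + p.2 <= n].
Proof.
apply/flatten_mapP/and3P => [[k ks]|[ps p2 pn]].
  by rewrite mem_stair_row mem_iota => /andP[/eqP->]; split=> //; lia.
by exists p.1; rewrite // mem_stair_row eqxx mem_iota; lia.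
Qed.

Lemma mem_staircase (n : nat) (p : nat * nat) :
  (p \in staircase n) = [&& 0 < p.1, 0 < p.2 & p.1 + p.2 <= n].
Proof. by rewrite mem_stair_rows !mem_iota; lia. Qed.

Lemma mem_P (n : nat) (p : nat * nat) : (p \in P n) = (p \in staircase n).
Proof.
rewrite mem_staircase !inE; case: p => k b /=.
apply/andP/and3P => [[/allpairsP[[k' b'] /= [+ + [-> ->]]]]|[k0 b0 kbn]].
  by rewrite !mem_iota => ? ? ?; split=> //; lia.
by split=> //; apply/allpairsP; exists (k, b); rewrite !mem_iota /=; split=> //; lia.
Qed.

Lemma staircase_split (n k b : nat) : 0 < k -> 0 < b -> k + b <= n ->
  staircase n =
    stair_rows n (iota 1 k.-1) ++ stair_row k (iota b.+1 (n - k - b)) ++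
    (k, b) :: stair_row k (iota 1 b.-1) ++ stair_rows n (iota k.+1 (n - k)).
Proof.
case: k b => // k [] // b _ _ kbn; rewrite /staircase.
have -> : iota 1 n = iota 1 k ++ k.+1 :: iota k.+2 (n - k.+1).
  by rewrite -[in LHS](subnKC (_ : k.+1 <= n)) ?addSnnS ?iotaD //; lia.
rewrite /stair_rows map_cat flatten_cat /= -[in LHS]/(stair_rows _ _).
have -> : iota 1 (n - k.+1) = iota 1 b ++ b.+1 :: iota b.+2 (n - k.+1 - b.+1).
  have {1}-> : n - k.+1 = b + (n - k.+1 - b.+1).+1 by lia.
  by rewrite iotaD.
rewrite /stair_row rev_cat rev_cons map_cat map_rcons cat_rcons -!catA //.
Qed.

Lemma rc_le_trans : transitive rc_le.
Proof. move=> [a b] [c d] [e f]; rewrite /rc_le /=; lia. Qed.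

Lemma rc_le_total : total rc_le.
Proof. move=> [a b] [c d]; rewrite /rc_le /=; lia. Qed.

Lemma rc_le_anti : antisymmetric rc_le.
Proof.
move=> [a b] [c d]; rewrite /rc_le /= => h.
have [-> ->] // : a = c /\ b = d by lia.
Qed.

Lemma staircase_pairwise (n : nat) : pairwise rc_le (staircase n).
Proof.
(* First row, size bound and number of rows are separated so that the induction can peel off the
   first row. *)
rewrite /staircase; move: (1) (n) {2}n => m n' c.
elim: c m => [|c IHc] m //=; rewrite pairwise_cat IHc andbT; apply/andP; split.
  apply/allrelP => p q; rewrite mem_stair_row mem_stair_rows !mem_iota /rc_le; lia.
elim: (n' - m) => [|d IHd] //; rewrite /stair_row iota_rcons rev_rcons /= IHd andbT.
apply/allP => p /mapP[b]; rewrite mem_rev mem_iota /rc_le => bd -> /=; lia.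
Qed.

Lemma staircase_uniq (n : nat) : uniq (staircase n).
Proof.
rewrite /staircase; move: (1) (n) {2}n => m n' c.
elim: c m => [|c IHc] m //=; rewrite cat_uniq IHc andbT; apply/andP; split.
  rewrite map_inj_uniq ?rev_uniq ?iota_uniq // => a b []; done.
apply/hasPn => p; rewrite mem_stair_row mem_stair_rows !mem_iota; lia.
Qed.

Lemma size_staircase (n : nat) : size (staircase n) = \sum_(i < n) i.
Proof.
rewrite size_flatten /shape -map_comp sumnE big_map.
under eq_bigr => k _ do rewrite /= size_map size_rev size_iota.
rewrite -(big_mkord xpredT id) big_nat_rev /= add0n /index_iota subn0 (iotaDl 1 0).
by rewrite big_map; apply: eq_bigr => i _; rewrite add1n.
Qed.

(** Every pair [i < j] is an inversion of [w_0], and each [j] has [j] smaller partners. *)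
Lemma perm_length_longest (n : nat) :
  perm_length (longest n) = size (staircase n).
Proof.
rewrite size_staircase /perm_length -sum1_card.
transitivity (\sum_(p : 'I_n * 'I_n | true && (p.1 < p.2)) 1).
  by apply: eq_bigl => p; rewrite inE !permE /= ltn_sub2lE // andbb.
rewrite -(pair_big_dep xpredT (fun i j : 'I_n => i < j) (fun _ _ => 1)) /=.
rewrite (exchange_big_dep xpredT) //=; apply: eq_bigr => j _.
by rewrite -(big_ord_widen n (fun _ => 1) (ltnW (ltn_ord j))) sum1_card card_ord.
Qed.

(** * Words of the staircase with labels removed *)

Definition stair_remove (n : nat) (A : seq (nat * nat)) : seq (nat * nat) :=
  [seq p <- staircase n | p \notin A].

(** Both lists are sorted for an antisymmetric order and have the same elements. *)
Lemma rc_word_remove (n : nat) (A : seq (nat * nat)) :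
  rc_word [fset p in P n | p \notin A]%fset = diagonals (stair_remove n A).
Proof.
congr map; apply: (sorted_eq rc_le_trans rc_le_anti).
- exact: sort_sorted rc_le_total _.
- apply: pairwise_sorted; exact: (pairwise_filter _ (staircase_pairwise n)).
rewrite perm_sort; apply: uniq_perm; rewrite ?fset_uniq ?filter_uniq ?staircase_uniq //.
by move=> p; rewrite mem_filter -mem_P !inE andbC.
Qed.

(** Each complete row is a decreasing run of letters and lowers the current value by one. *)
Lemma word_act_rows (n k b : nat) : 0 < b -> k + b <= n ->
  word_act (diagonals (stair_rows n (iota 1 k))) (k + b) = b.
Proof.
move=> b0; elim: k => [|k IHk] kbn //.
rewrite iota_rcons /stair_rows map_rcons -cats1 flatten_cat diagonals_cat word_act_cat /=.
rewrite cats0 diagonals_row addn0 word_act_rev_iota_down /=; last lia.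
by rewrite IHk // ltnW.
Qed.

Lemma word_act_above (s : seq (nat * nat)) (x : nat) :
  (forall p, p \in s -> x.+1 < p.1 + p.2) -> word_act (diagonals s) x = x.
Proof.
move=> above; apply: word_act_fix; rewrite all_map.
by apply/allP => p /above /=; lia.
Qed.

(** Rows after [x] fix [x], row [x] carries it up to [n], and the [x-1] earlier rows lower it one by
    one. *)
Lemma word_act_staircase (n x : nat) : 0 < x <= n ->
  word_act (diagonals (staircase n)) x = n.+1 - x.
Proof.
case: x => // x /andP[_ xn].
have iotaE : iota 1 n = iota 1 x ++ x.+1 :: iota x.+2 (n - x.+1).
  by rewrite -[in LHS](subnKC xn) addSnnS iotaD.
have fix_x : word_act (diagonals (stair_rows n (iota x.+2 (n - x.+1)))) x.+1 = x.+1.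
  by apply: word_act_above => -[a b]; rewrite mem_stair_rows mem_iota /=; lia.
rewrite /staircase iotaE /stair_rows map_cat flatten_cat diagonals_cat word_act_cat /=.
rewrite diagonals_cat word_act_cat fix_x diagonals_row addn0 word_act_rev_iota.
rewrite subnKC // subSS.
by rewrite -{2}(subnKC (ltnW xn)) word_act_rows ?subn_gt0 ?subnKC // ltnW.
Qed.

(** As [A] lies beyond [(k, b)], the rows before [k] and the entries of row [k] below [b] are
    intact. So in [C] the later rows fix [k] and the rest of row [k] lifts it to [k+b-1]; in [F] the
    larger entries of row [k] fix [k+b-1] and the [k-1] full rows lower it to [b]. *)
Lemma stair_remove_cons (n k b : nat) (A : seq (nat * nat)) :
    (k, b) \in staircase n -> all (label_lt (k, b)) A ->
  exists F C, [/\ diagonals (stair_remove n A) = F ++ (k + b - 1) :: C,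
    diagonals (stair_remove n ((k, b) :: A)) = F ++ C,
    word_act C k = k + b - 1 & word_act F (k + b - 1) = b].
Proof.
rewrite mem_staircase /= => /and3P[k0 b0 kbn] /allP lt_A.
have notA (p : nat * nat) : (p.1 < k) || (p.1 == k) && (p.2 <= b) -> p \notin A.
  by move=> pkb; apply/negP => /lt_A; move: pkb; rewrite /label_lt /=; lia.
pose R1 := stair_rows n (iota 1 k.-1).
pose R2 := stair_row k (iota b.+1 (n - k - b)).
pose R3 := stair_row k (iota 1 b.-1).
pose R4 := stair_rows n (iota k.+1 (n - k)).
have splitE : staircase n = R1 ++ R2 ++ (k, b) :: R3 ++ R4 by apply: staircase_split.
have R1P (p : nat * nat) : p \in R1 -> p.1 < k by rewrite mem_stair_rows mem_iota; lia.
have R2P (p : nat * nat) : p \in R2 -> (p.1 == k) && (b < p.2).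
  by rewrite mem_stair_row mem_iota; lia.
have R3P (p : nat * nat) : p \in R3 -> (p.1 == k) && (p.2 < b).
  by rewrite mem_stair_row mem_iota; lia.
have R4P (p : nat * nat) : p \in R4 -> k < p.1 /\ 0 < p.2.
  by rewrite mem_stair_rows mem_iota; lia.
have keep (s : seq (nat * nat)) : (forall p, p \in s -> p != (k, b)) ->
    [seq p <- s | p \notin (k, b) :: A] = [seq p <- s | p \notin A].
  by move=> ns; apply: eq_in_filter => p /ns /negPf pkb; rewrite inE pkb.
have keep_all (s : seq (nat * nat)) : (forall p, p \in s -> p \notin A) ->
    [seq p <- s | p \notin A] = s.
  by move=> /allP/all_filterP.
have ne (p : nat * nat) : (p.1 != k) || (p.2 != b) -> p != (k, b).
  by case: p => ? ?; rewrite xpair_eqE negb_and.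
exists (diagonals (R1 ++ [seq p <- R2 | p \notin A])).
exists (diagonals (R3 ++ [seq p <- R4 | p \notin A])).
rewrite /stair_remove splitE !filter_cat /= mem_head notA ?eqxx ?leqnn ?orbT //=.
have [ne1 ne2 ne3 ne4] : [/\ forall p : nat * nat, p \in R1 -> p != (k, b),
    forall p : nat * nat, p \in R2 -> p != (k, b),
    forall p : nat * nat, p \in R3 -> p != (k, b)
    & forall p : nat * nat, p \in R4 -> p != (k, b)].
  by split=> p /[dup] pR; [move/R1P|move/R2P|move/R3P|move/R4P];
    move=> ?; apply: ne; lia.
have all1 (p : nat * nat) : p \in R1 -> p \notin A.
  by move=> /R1P ?; apply: notA; lia.
have all3 (p : nat * nat) : p \in R3 -> p \notin A.
  by move=> /R3P ?; apply: notA; lia.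
rewrite !filter_cat !keep // !(keep_all R1) // !(keep_all R3) //.
split.
- by rewrite !diagonals_cat -!catA /= -diagonals_cat.
- by rewrite !diagonals_cat -!catA.
- rewrite diagonals_cat word_act_cat (@word_act_above [seq p <- R4 | p \notin A]).
    rewrite /R3 -(prednK k0) diagonals_row addn0 word_act_rev_iota; lia.
  by move=> -[c d]; rewrite mem_filter => /andP[_ /R4P] /=; lia.
rewrite diagonals_cat word_act_cat (@word_act_above [seq p <- R2 | p \notin A]).
  have -> : k + b - 1 = k.-1 + b by lia.
  by rewrite word_act_rows //; lia.
by move=> -[c d]; rewrite mem_filter => /andP[_ /R2P] /=; lia.
Qed.

Lemma all_diagonals_remove (n : nat) (A : seq (nat * nat)) :
  all (fun a => 0 < a < n) (diagonals (stair_remove n A)).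
Proof.
rewrite all_map; apply/allP => -[k b].
rewrite mem_filter mem_staircase /=; lia.
Qed.

(* With [F ++ a :: C] a word for [v] and [F ++ C] the word without its letter
   [a = k+b-1], the two products differ by the transposition of the positions
   that [C] sends to [a] and [a+1]; these are [k] and the position where [v]
   takes the value [b]. *)
Lemma word_prod_remove (n k b : nat) (A : seq (nat * nat)) (v : 'S_n)
    (i l : 'I_n) :
    (k, b) \in staircase n -> all (label_lt (k, b)) A ->
    v = word_prod n (diagonals (stair_remove n A)) ->
    i.+1 = k -> (v l).+1 = b ->
  pmul v (tperm i l) = word_prod n (diagonals (stair_remove n ((k, b) :: A))).
Proof.
move=> kb_in lt_A vE iE vl.
have [F [C [dA dkbA Ck Fb]]] := stair_remove_cons kb_in lt_A.
set a := k + b - 1 in dA Ck Fb.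
have vact m : (v m).+1 = word_act F (swap_succ a (word_act C m.+1)).
  by rewrite vE word_prodE ?all_diagonals_remove // dA word_act_cat.
(* [F] sends [a] to [b], the value of [v] at [l], so the letter [a] must receive [a+1] from [C]. *)
have Cl : word_act C l.+1 = a.+1.
  apply: (inv_inj (swap_succK a)); apply: (@word_act_inj F).
  by rewrite -vact vl -Fb /swap_succ eqxx; case: ifP => // /eqP; lia.
apply/permP => m; apply/val_inj/succn_inj.
rewrite word_prodE ?all_diagonals_remove // dkbA word_act_cat permM vact.
case: tpermP => [->|->|/eqP mi /eqP ml].
- by rewrite Cl iE Ck Fb /swap_succ eqxx; case: ifP => // /eqP; lia.
- by rewrite iE Ck Cl /swap_succ eqxx.
congr word_act; rewrite /swap_succ -{1}Ck -Cl !(inj_eq (@word_act_inj C)) -iE !eqSS.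
by rewrite !val_eqE (negPf mi) (negPf ml).
Qed.

(** * Reduced words along the chain *)

Lemma label_lt_trans : transitive label_lt.
Proof. move=> [a b] [c d] [e f]; rewrite /label_lt /=; lia. Qed.

Lemma increasing_chain_word (n : nat) (x : 'S_n) (g : seq (edge n)) :
    increasing_chain x g (longest n) ->
  reduced_decomposition x (diagonals (stair_remove n (chain_labels g))).
Proof.
elim: g x => [|e g IHg] x inc.
  have /andP[/eqP-> _] := inc.
  rewrite /stair_remove /= filter_predT; apply/andP; split.
    apply/eqP/permP => i; apply/val_inj/succn_inj.
    have := all_diagonals_remove n [::]; rewrite /stair_remove filter_predT.
    move/word_prodE => ->.
    by rewrite word_act_staircase ?ltn_ord // permE /= subSS subnSK.
  by rewrite size_map perm_length_longest.
have [i [l [eE il uil between top]]] := increasing_chain_head inc.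
case: e eE il uil between top inc => [[u [k b]] v] /= [-> -> ->] il uil between top.
case/andP=> /= /and3P[/eqP <- _ chain] sorted_g.
have {}IHg := IHg _ (introT andP (conj chain (path_sorted sorted_g))).
case/andP: IHg => /eqP vE /eqP szE.
have lt_g := order_path_min label_lt_trans sorted_g.
(* [u i < u l] together with the bound [u l + i < n] gives [k + b <= n]. *)
have kb_in : (i.+1, (u i).+1) \in staircase n.
  rewrite mem_staircase /=.
  have := top_fixed_bound top (ltnW il); lia.
apply/andP; split.
  rewrite -(word_prod_remove (i := i) (l := l) kb_in lt_g vE) //.
    by apply/eqP; rewrite /pmul mulgA tperm2 mul1g.
  by rewrite permM tpermR.
have [F [C [dA dkbA _ _]]] := stair_remove_cons kb_in lt_g.
(* Going back along the cover lowers the length by one, and the word loses exactly one letter. *)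
rewrite dkbA -eqSS -(perm_length_cover il uil between) -szE dA !size_cat.
by rewrite [size (_ :: C)]/= addnS.
Qed.

Theorem theorem2p4 (n : nat) (w : 'S_n) (g : seq (edge n))
    (Hg : increasing_chain w g (longest n)) :
  (forall (u v : 'S_n) (k b : nat), (u, (k, b), v) \in g ->
     exists i l : 'I_n,
       [/\ i.+1 = k, i < l & pmul u^-1%g v = tperm i l])
  /\ rc_graph n [fset kb in P n | kb \notin chain_labels g]%fset.
Proof.
split=> [u v k b /(increasing_chain_edges Hg) [i [l [/= [-> _ ->] il _ _ _]]]|].
  by exists i, l; rewrite /pmul mulgK.
exists w; split; first by apply/fsubsetP => p; rewrite !inE => /andP[].
by rewrite rc_word_remove; apply: increasing_chain_word.
Qed.
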